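(* For every integer $k \geq 2$ there exist constants $C_k, c_k > 0$ such that the following holds. For any $k$-uniform $k$-partite hypergraph $H$ with at least two edges, the Tur\'an number of $H$ satisfies \[\Omega_k\left(n^{k-\frac{C_k}{d_1(H)}}\right) \leq \mathrm{ex}(n,H) \leq O_H\left(n^{k-\frac{c_k}{d_1(H)^{k-1}}}\right).\]
   Context: For a $k$-uniform hypergraph $H$, the Tur\'an number $\mathrm{ex}(n,H)$ is the maximum number of edges in a $k$-uniform hypergraph on $n$ vertices containing no copy of $H$. A hypergraph is $k$-partite if its vertex set can be partitioned into $k$ parts so that each edge has exactly one vertex in each part. For $0 \le i < k$, the $i$-skeleton $H^{(i)}$ of $H$ is the $(i+1)$-uniform hypergraph on $V(H)$ whose edges are all $(i+1)$-sets contained in some edge of $H$. The $i$-th skeletal degeneracy $d_i(H)$ is the degeneracy of $H^{(i)}$, i.e. the least $d$ such that every subhypergraph of $H^{(i)}$ has minimum degree at most $d$; $d_1(H)$ (the degeneracy of the graph obtained by replacing each edge of $H$ by a $k$-clique) is called the skeletal degeneracy. $\Omega_k(f(n))$ denotes a quantity at least $c f(n)$ for some $c>0$ depending only on $k$ and all sufficiently large $n$; $O_H(f(n))$ denotes a quantity at most $C f(n)$ for some $C$ depending only on $H$. *)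

(* Defs.v *)
From mathcomp Require Import all_boot all_order all_algebra.
From mathcomp Require Import reals exp.

Set Implicit Arguments.
Unset Strict Implicit.
Unset Printing Implicit Defensive.

(* A hypergraph is given by its finite vertex type [V] and its edge set
   [H : {set {set V}}]; vertices contained in no edge are allowed. *)

Section Hypergraphs.
Variable V : finType.
Implicit Types (H F : {set {set V}}) (W : {set V}).

Definition uniform (k : nat) H : bool := [forall e in H, #|e| == k].

(* The parts are the fibres of [part]. *)
Definition partite (k : nat) H : Prop :=
  exists part : V -> 'I_k,
    forall (e : {set V}) (j : 'I_k), e \in H ->
      #|[set v in e | part v == j]| = 1.

Definition skeleton (i : nat) H : {set {set V}} :=
  [set s : {set V} | (#|s| == i.+1) && [exists e in H, s \subset e]].

Definition degree F (v : V) : nat := #|[set e in F | v \in e]|.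

(* Degrees never exceed [#|F|], so for nonempty [W] the default value of the
   iterated minimum does not affect the result. *)
Definition min_degree W F : nat := \big[minn/#|F|]_(v in W) degree F v.

(* [(W, F)] is a subhypergraph (not necessarily induced or spanning) with at
   least one vertex of the hypergraph [H]. *)
Definition subhypergraph W F H : bool :=
  [&& W != set0, F \subset H & [forall e in F, e \subset W]].

Definition degenerate (d : nat) H : bool :=
  [forall W : {set V}, forall F : {set {set V}},
     subhypergraph W F H ==> (min_degree W F <= d)].

Lemma degenerate_exists H : exists d, degenerate d H.
Proof.
exists #|H|; apply/forallP=> W; apply/forallP=> F; apply/implyP.
case/and3P=> _ sFH _; apply: leq_trans (subset_leq_card sFH).
rewrite /min_degree; elim/big_rec: _ => // v m _ le_m.
exact: leq_trans (geq_minr _ _) le_m.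
Qed.

Definition degeneracy H : nat := ex_minn (degenerate_exists H).

Definition skeletal_degeneracy (i : nat) H : nat := degeneracy (skeleton i H).

End Hypergraphs.

(* [G] contains a (not necessarily induced) copy of [H]. *)
Definition contains_copy (V W : finType)
    (H : {set {set V}}) (G : {set {set W}}) : bool :=
  [exists f : {ffun V -> W},
     injectiveb f && [forall e in H, [set f x | x in e] \in G]].

Definition turan (k n : nat) (V : finType) (H : {set {set V}}) : nat :=
  \max_(G : {set {set 'I_n}} | uniform k G && ~~ contains_copy H G) #|G|.

(* Main.v *)
Require Import Defs.
From mathcomp Require Import all_boot all_order all_algebra.
From mathcomp Require Import reals exp.
From mathcomp Require Import zify ring lra.

(** Write d for the skeletal degeneracy.

    Upper bound: let G be a k-graph on n vertices with e(G) > B n^(k - eps).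
    Choose for every part i of H a random s-tuple T_i of vertices of G, with
    s = 2d + 1. By convexity all the s^k transversals of (T_1, ..., T_k) are
    edges of G with probability at least n^(- eps s^k). Embed V(H) greedily
    along an ordering in which every vertex has at most d earlier neighbours in
    the skeleton, keeping the invariant that every edge of H, with its vertices
    not yet embedded replaced by arbitrary entries of the corresponding tuples,
    is an edge of G. When v, in part j, is to be embedded, the set L of its
    admissible images depends only on the images of at most d vertices and on
    the T_i with i <> j, and the invariant says that all entries of T_j lie in
    L. So a step can only fail if T_j falls into some L with |L| < |V(H)|, and
    by a union bound this has probability O_H(n^(d - s)), which is smaller than
    n^(- eps s^k) for eps = 3^-k / d^(k-1).

    Lower bound: the skeleton has a subgraph F on w vertices with at least
    d w / 2 edges. Take a random graph of density about n^(- 8 / d) and the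
    k-graph of its k-cliques: a copy of H there forces a copy of F in the
    graph, which is unlikely, while n^(k - O_k(1 / d)) cliques are expected. *)

Set Implicit Arguments.
Unset Strict Implicit.
Unset Printing Implicit Defensive.

(** * Convexity for blow-ups *)

Definition upd (I : finType) (Y : Type) (T : {ffun I -> Y}) (j : I) (y : Y) :
  {ffun I -> Y} := [ffun i => if i == j then y else T i].

Lemma upd_same (I : finType) (Y : Type) (T : {ffun I -> Y}) j y :
  upd T j y j = y.
Proof. by rewrite ffunE eqxx. Qed.

Lemma upd_id (I : finType) (Y : Type) (T : {ffun I -> Y}) j : upd T j (T j) = T.
Proof. by apply/ffunP=> i; rewrite ffunE; case: eqP => [->|]. Qed.

Lemma upd_upd (I : finType) (Y : Type) (T : {ffun I -> Y}) j y z :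
  upd (upd T j y) j z = upd T j z.
Proof. by apply/ffunP=> i; rewrite !ffunE; case: eqP. Qed.

(* [(T, y) |-> (upd T j y, T j)] is an involution. *)
Lemma sum_resample (I Y : finType) (j : I) (F : {ffun I -> Y} -> nat) :
  \sum_T \sum_y F (upd T j y) = #|Y| * \sum_T F T.
Proof.
rewrite (pair_bigA _ (fun T y => F (upd T j y))) /=.
pose h (p : {ffun I -> Y} * Y) := (upd p.1 j p.2, p.1 j).
have hK : involutive h.
  by move=> [T y]; rewrite /h /= upd_upd upd_id upd_same.
rewrite (reindex_inj (inv_inj hK)) /=.
under eq_bigr do rewrite upd_upd upd_id.
rewrite -(pair_bigA _ (fun T _ => F T)) /= big_distrr /=.
by apply: eq_bigr => T _; rewrite sum_nat_const.
Qed.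

(** Summing [(a i - a j) * (b i - b j) >= 0] over all pairs, with the negative terms moved to the
    other side. *)
Lemma chebyshev_sum (I : finType) (a b : I -> nat) :
  (forall i j, a i <= a j -> b i <= b j) ->
  (\sum_i a i) * (\sum_i b i) <= #|I| * \sum_i a i * b i.
Proof.
move=> mono; rewrite -leq_double -!muln2 -!mulnA.
have E1 : \sum_i \sum_j (a i * b j + a j * b i) =
  (\sum_i a i) * (\sum_i b i) * 2.
  under eq_bigr do rewrite big_split /=.
  by rewrite big_split /= [X in _ + X]exchange_big /= -big_distrlr /= addnn muln2.
have E2 : \sum_i \sum_j (a i * b i + a j * b j) =
  #|I| * (\sum_i a i * b i) * 2.
  under eq_bigr do rewrite big_split /= sum_nat_const.
  by rewrite big_split /= sum_nat_const -big_distrr /= muln2 addnn.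
rewrite !mulnA -E1 -E2; apply: leq_sum => i _; apply: leq_sum => j _.
have := mono i j; have := mono j i; nia.
Qed.

(** Induction on [s]: Chebyshev applies to [a] and its power [a ^ s.+1], which are ordered alike. *)
Lemma power_mean (I : finType) (a : I -> nat) (s : nat) :
  (\sum_i a i) ^ s.+1 <= #|I| ^ s * \sum_i a i ^ s.+1.
Proof.
elim: s => [|s IH]; first by rewrite mul1n; under [in leqRHS]eq_bigr do rewrite expn1.
rewrite expnS; apply: leq_trans (leq_mul (leqnn _) IH) _.
rewrite mulnCA expnSr -mulnA leq_mul2l; apply/orP; right.
apply: leq_trans (chebyshev_sum _) _.
  by move=> i j; rewrite leq_exp2r.
by under eq_bigr do rewrite -expnS.
Qed.

Section Blowup.
Variables (X : finType) (k s : nat) (P : pred {ffun 'I_k -> X}).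
Hypothesis X_gt0 : 0 < #|X|.
Local Notation tuples := {ffun 'I_k -> {ffun 'I_s.+1 -> X}}.
Implicit Type T : tuples.

Definition transversal_of T (c : {ffun 'I_k -> 'I_s.+1}) : {ffun 'I_k -> X} :=
  [ffun i => T i (c i)].

(* Only the first [j] coordinates are blown up: in the others, a transversal
   has to use the first entry of the tuple. *)
Definition blowup (j : nat) : {set tuples} :=
  [set T | [forall c : {ffun 'I_k -> 'I_s.+1},
     [forall i : 'I_k, (j <= i) ==> (c i == ord0)] ==> P (transversal_of T c)]].

(** A transversal reads only entry [c j] of the [j]-th tuple, so this tuple may be made constant and
    the choice at [j] altered. *)
Lemma transversal_upd T (j : 'I_k) (y : {ffun 'I_s.+1 -> X})
    (c : {ffun 'I_k -> 'I_s.+1}) i :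
  transversal_of (upd T j [ffun=> y (c j)]) (upd c j i) =
  transversal_of (upd T j y) c.
Proof. by apply/ffunP=> l; rewrite !ffunE; case: eqP => // ->; rewrite ffunE. Qed.

(** A constant tuple tests a single value [x]; this is enough because [blowup j] reads only the
    first entry in coordinate [j]. *)
Let D (j : 'I_k) T := [set x | upd T j [ffun=> x] \in blowup j].

Lemma mem_blowup_upd (j : 'I_k) T (y : {ffun 'I_s.+1 -> X}) :
  (upd T j y \in blowup j) = (y ord0 \in D j T).
Proof.
rewrite !inE; apply: eq_forallb => c.
case: forallP => //= /(_ j); rewrite leqnn /= => /eqP cj.
by rewrite -(transversal_upd T j y c (c j)) cj -{2}cj upd_id.
Qed.

(** At level [j.+1] the choice at [j] is free: redirecting it to [i] tests entry [i], and resetting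
    it to [ord0] returns to level [j]. *)
Lemma mem_blowupS_upd (j : 'I_k) T (y : {ffun 'I_s.+1 -> X}) :
  (upd T j y \in blowup j.+1) = (y \in ffun_on (mem (D j T))).
Proof.
apply/idP/ffun_onP.
- rewrite inE => /forallP Ty i; rewrite inE /= inE.
  apply/forallP=> c; apply/implyP=> /forallP c0.
  have /implyP := Ty (upd c j i).
  rewrite -(transversal_upd T j y (upd c j i) (c j)) upd_same upd_upd upd_id.
  apply; apply/forallP=> l; apply/implyP=> ltjl; rewrite ffunE.
  have -> : l == j = false by apply/eqP=> e; rewrite e ltnn in ltjl.
  by have := c0 l; rewrite (ltnW ltjl).
- move=> yD; rewrite inE; apply/forallP=> c; apply/implyP=> /forallP c0.
  have := yD (c j); rewrite inE /= inE => /forallP /(_ (upd c j ord0)).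
  rewrite transversal_upd => /implyP; apply.
  apply/forallP=> l; apply/implyP=> lejl; rewrite ffunE.
  case: (l =P j) => // /eqP nlj; have := c0 l.
  by rewrite ltn_neqAle lejl andbT eq_sym nlj.
Qed.

Lemma card_ffun_ord0 (A : {set X}) :
  \sum_(y : {ffun 'I_s.+1 -> X}) (y ord0 \in A) = #|A| * #|X| ^ s.
Proof.
apply/eqP; rewrite -(eqn_pmul2l X_gt0); apply/eqP.
rewrite -(sum_resample ord0 (fun y : {ffun 'I_s.+1 -> X} => (y ord0 \in A) : nat)).
under eq_bigr => y _ do under eq_bigr => x _ do rewrite upd_same.
rewrite sum_nat_const card_ffun card_ord -sum1_card -big_mkcond /=.
by rewrite expnS mulnAC mulnA.
Qed.

(* For fixed other coordinates, [upd T j y] is in [blowup j.+1] iff all entries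
   of [y] are in [D j T], and in [blowup j] iff the first one is. *)
Lemma blowup_step (j : 'I_k) :
  #|blowup j| ^ s.+1 <= #|blowup j.+1| * #|{: tuples}| ^ s.
Proof.
have cardY : #|{: {ffun 'I_s.+1 -> X}}| = #|X| ^ s.+1 by rewrite card_ffun card_ord.
(* In densities: [blowup j] has the mean density of the sets [D j T], and [blowup j.+1] has the mean
   of its power [s.+1]. *)
have Ej : #|X| * #|blowup j| = \sum_T #|D j T|.
  apply/eqP; rewrite -(@eqn_pmul2r (#|X| ^ s)) ?expn_gt0 ?X_gt0 //; apply/eqP.
  rewrite mulnAC -expnS -cardY -sum1_card big_mkcond /=.
  rewrite -(sum_resample j) big_distrl /=; apply: eq_bigr => T _.
  rewrite -card_ffun_ord0; apply: eq_bigr => y _.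
  by rewrite mem_blowup_upd; case: ifP.
have EjS : #|X| ^ s.+1 * #|blowup j.+1| = \sum_T #|D j T| ^ s.+1.
  rewrite -cardY -sum1_card big_mkcond -(sum_resample j).
  apply: eq_bigr => T _; under eq_bigr do rewrite mem_blowupS_upd.
  by rewrite -big_mkcond sum1_card card_ffun_on card_ord.
have := power_mean (fun T => #|D j T|) s.
rewrite -Ej -EjS expnMn mulnCA leq_pmul2l ?expn_gt0 ?X_gt0 //.
by rewrite mulnC.
Qed.

(** Each step costs at most a power [s.+1] of the density; the last factor clears denominators. *)
Lemma blowup_iter (j : nat) : j <= k ->
  #|blowup 0| ^ (s.+1 ^ j) <= #|blowup j| * #|{: tuples}| ^ (s.+1 ^ j).-1.
Proof.
elim: j => [|j IH] ltjk; first by rewrite expn0 expn1 muln1.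
rewrite expnSr expnM.
have := IH (ltnW ltjk); rewrite -(leq_exp2r _ _ (ltn0Sn s)) => /leq_trans; apply.
rewrite expnMn -expnM.
apply: leq_trans (leq_mul (blowup_step (Ordinal ltjk)) (leqnn _)) _.
rewrite -mulnA leq_mul2l -expnD; apply/orP; right.
rewrite leq_eqVlt; apply/orP; left; apply/eqP; congr (_ ^ _).
by have := expn_gt0 s.+1 j; case: (s.+1 ^ j).
Qed.

(** With nothing blown up only the [k] first entries are constrained; the other [k * s] entries are
    free. *)
Lemma card_blowup0 : #|blowup 0| = #|P| * #|X| ^ (k * s).
Proof.
pose c0 : {ffun 'I_k -> 'I_s.+1} := [ffun=> ord0].
have b0 T : (T \in blowup 0) = (transversal_of T c0 \in P).
  rewrite inE; apply/forallP/idP => [/(_ c0) /implyP|PT c].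
    by apply; apply/forallP=> i; rewrite ffunE.
  apply/implyP=> /forallP c_0; suff -> : c = c0 by [].
  by apply/ffunP=> i; rewrite ffunE; apply/eqP/c_0.
rewrite -sum1_card (eq_bigl (fun T => transversal_of T c0 \in P)) //.
rewrite (partition_big (fun T => transversal_of T c0) (mem P)) //=.
rewrite -sum_nat_const; apply: eq_bigr => g Pg.
pose fiber i := [pred y : {ffun 'I_s.+1 -> X} | y ord0 \in [set g i]].
rewrite (eq_bigl (fun T => T \in family fiber)); last first.
  move=> T; apply/andP/familyP => [[_ /eqP eTg] i|Tg].
    by rewrite !inE -eTg !ffunE.
  have -> : transversal_of T c0 = g.
    by apply/ffunP=> i; rewrite !ffunE; have := Tg i; rewrite !inE => /eqP.
  by [].
have card_fiber i : #|fiber i| = #|X| ^ s.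
  rewrite -[RHS]mul1n -(cards1 (g i)) -card_ffun_ord0 -sum1_card big_mkcond.
  by apply: eq_bigr => y _; rewrite -topredE /=; case: (y ord0 \in _).
rewrite sum1_card card_family foldrE big_map big_enum /=.
under eq_bigr do rewrite card_fiber.
by rewrite prod_nat_const card_ord -expnM mulnC.
Qed.

End Blowup.

(** * Greedy embedding into blow-ups *)

Lemma card_union_bound (I X : finType) (P : pred I) (A : {set X}) (B : I -> {set X}) :
  (forall x, x \in A -> exists2 i, P i & x \in B i) ->
  #|A| <= \sum_(i | P i) #|B i|.
Proof.
move=> AB; under eq_bigr do rewrite -sum1_card big_mkcond.
rewrite exchange_big -sum1_card big_mkcond; apply: leq_sum => x _ /=.
by case: ifP => // /AB [i Pi xBi]; rewrite (bigD1 i) //= xBi.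
Qed.

Lemma leq_min_degree (V : finType) (W : {set V}) (F : {set {set V}}) d :
  W != set0 -> (forall v, v \in W -> d <= degree F v) -> d <= min_degree W F.
Proof.
case/set0Pn=> v vW dW; rewrite /min_degree.
elim/big_ind: _ => // [|a b da db]; last by rewrite leq_min da.
(* The default value [#|F|] of the minimum is at least every degree. *)
apply: leq_trans (dW v vW) _; apply: subset_leq_card.
by apply/subsetP=> e; rewrite inE => /andP[].
Qed.

Definition nbrs (V : finType) (H : {set {set V}}) (v : V) (W : {set V}) :=
  [set u in W | (u != v) && [exists e in H, (u \in e) && (v \in e)]].

(** The skeleton graph induced on [W] has a vertex [v] of degree at most the degeneracy, and [u |->
    [set u; v]] maps its neighbours injectively to edges at [v]. *)
Lemma low_degree_vertex (V : finType) (H : {set {set V}}) (W : {set V}) :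
  W != set0 ->
  exists2 v, v \in W & #|nbrs H v W| <= skeletal_degeneracy 1 H.
Proof.
move=> W0; rewrite /skeletal_degeneracy /degeneracy.
case: ex_minnP => d /forallP/(_ W)/forallP degH _.
pose F := [set s in skeleton 1 H | s \subset W].
have /implyP := degH F.
have -> : subhypergraph W F (skeleton 1 H).
  apply/and3P; split=> //; first by apply/subsetP=> s; rewrite inE => /andP[].
  by apply/forallP=> s; apply/implyP; rewrite inE => /andP[].
move=> /(_ isT) le_d.
have [/existsP[v /andP[vW ?]]|] := boolP [exists v in W, #|nbrs H v W| <= d].
  by exists v.
rewrite negb_exists => /forallP high; move: le_d; rewrite leqNgt.
case/negP; apply: leq_min_degree => // v vW.
have := high v; rewrite vW /= -ltnNge => /leq_trans; apply.
have <- : #|[set [set u; v] | u in nbrs H v W]| = #|nbrs H v W|.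
  apply: card_in_imset => u u'; rewrite !inE => /and3P[_ uv _] _ E.
  by have := set21 u v; rewrite E !inE (negPf uv) orbF => /eqP.
apply: subset_leq_card; apply/subsetP=> _ /imsetP[u + ->].
rewrite !inE => /and3P[uW uv /existsP[e /and3P[eH ue ve]]].
rewrite eqxx orbT andbT cards2 uv /= subUset !sub1set uW vW !andbT.
by apply/existsP; exists e; rewrite eH subUset !sub1set ue ve.
Qed.

Section Embedding.
Variables (V X : finType) (k s d : nat) (H : {set {set V}}) (G : {set {set X}}).
Variable part : V -> 'I_k.
Hypothesis H_part : forall (e : {set V}) (j : 'I_k), e \in H ->
  #|[set v in e | part v == j]| = 1.
Hypothesis H_degen : forall W : {set V}, W != set0 ->
  exists2 v, v \in W & #|nbrs H v W| <= d.
Local Notation tuples := {ffun 'I_k -> {ffun 'I_s.+1 -> X}}.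
Implicit Types (T : tuples) (W : {set V}) (phi : {ffun V -> X}) (v : V).
Implicit Type c : {ffun 'I_k -> 'I_s.+1}.

Lemma part_inj e u v : e \in H -> u \in e -> v \in e -> part u = part v -> u = v.
Proof.
move=> eH ue ve uv; have /eqP/cards1P[w E] := H_part (part v) eH.
have : u \in [set w] by rewrite -E inE ue uv eqxx.
have : v \in [set w] by rewrite -E inE ve eqxx.
by rewrite !inE => /eqP-> /eqP.
Qed.

Lemma part_surj e j : e \in H -> exists2 u, u \in e & part u = j.
Proof.
move=> eH; have /eqP/cards1P[w E] := H_part j eH.
have : w \in [set w] by rewrite inE.
by rewrite -E inE => /andP[we /eqP]; exists w.
Qed.

(** One choice per part is as good as one per vertex, since an edge of [H] meets each part once. *)
Definition fill T c W phi (u : V) : X :=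
  if u \in W then phi u else T (part u) (c (part u)).

(* [phi] embeds [W]; the vertices outside [W] are represented by all the
   entries of the tuple of their part. *)
Definition partial_copy T W phi : Prop := forall e c, e \in H ->
  [set fill T c W phi u | u in e] \in G.

(** The admissible images of [v]. Edges avoiding [v] are not tested, as the invariant for them is
    unaffected. *)
Definition extensions T v W phi : {set X} :=
  [set x | [forall e in H, (v \in e) ==> [forall c : {ffun 'I_k -> 'I_s.+1},
     [set fill T c (v |: W) (upd phi v x) u | u in e] \in G]]].

(** In an edge through [v], the other embedded vertices are neighbours of [v], and the remaining
    ones lie in other parts than [v]. *)
Lemma eq_extensions T T' v W phi phi' :
  (forall i, i != part v -> T i = T' i) ->
  {in nbrs H v W, phi =1 phi'} ->
  extensions T v W phi = extensions T' v W phi'.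
Proof.
move=> eT ephi; apply/setP=> x; rewrite !inE; apply: eq_forallb => e.
have [eH|//] := boolP (e \in H); have [ve|//] := boolP (v \in e).
apply: eq_forallb => c /=; congr (_ \in G); apply: eq_in_imset => u ue.
rewrite /fill !inE !ffunE; have [//|uv] := eqVneq u v; rewrite /=.
case: ifP => uW.
  apply: ephi; rewrite inE uW uv; apply/existsP; exists e.
  by rewrite eH ue ve.
by rewrite eT //; apply: contraNneq uv => /(part_inj eH ue ve)->.
Qed.

(** Mapping [v] to entry [i] of its tuple amounts to leaving [v] unembedded and redirecting the
    choice in its part to [i]. *)
Lemma entry_extends T v W phi i : v \notin W -> partial_copy T W phi ->
  T (part v) i \in extensions T v W phi.
Proof.
move=> vW TW; rewrite inE; apply/forallP=> e; apply/implyP=> eH.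
apply/implyP=> ve; apply/forallP=> c.
rewrite -[X in X \in G](_ : [set fill T (upd c (part v) i) W phi u | u in e] = _).
  exact: TW.
apply: eq_in_imset => u ue; rewrite /fill !inE !ffunE.
have [->|uv] := eqVneq u v; first by rewrite (negPf vW) eqxx.
case: (part u =P part v) => // /(part_inj eH ue ve) E.
by rewrite E eqxx in uv.
Qed.

Definition bad T v W phi : bool :=
  [forall i, T (part v) i \in extensions T v W phi] &&
  (#|extensions T v W phi| < #|V|).

(** Induction on [#|W|]: a vertex with at most [d] neighbours in [W] is embedded after all
    others. *)
Lemma greedy_embedding T phi0 : partial_copy T set0 phi0 ->
  (forall v W phi, v \notin W -> #|nbrs H v W| <= d -> ~~ bad T v W phi) ->
  forall W, exists2 phi : {ffun V -> X}, {in W &, injective phi} & partial_copy T W phi.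
Proof.
move=> T0 good W; have [m] := ubnP #|W|; elim: m W => // m IH W.
have [-> _|W0] := eqVneq W set0; first by exists phi0 => // u v; rewrite inE.
have [v vW deg_v] := H_degen W0; rewrite (cardsD1 v) vW ltnS => ltm.
have [phi phi_inj phiW] := IH _ ltm.
have vW' : v \notin W :\ v by rewrite !inE eqxx.
have deg_v' : #|nbrs H v (W :\ v)| <= d.
  apply: leq_trans deg_v; apply: subset_leq_card; apply/subsetP=> u.
  by rewrite !inE => /and3P[/andP[_ ->] -> ->].
have := good v _ phi vW' deg_v'; rewrite negb_and -leqNgt.
case/orP=> [/forallPn[i]|le_ext]; first by rewrite entry_extends.
(* Fewer than [#|V|] images are taken, so some admissible image is new. *)
have : ~~ (extensions T v (W :\ v) phi \subset phi @: (W :\ v)).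
  apply/negP=> /subset_leq_card; rewrite leqNgt => /negP; apply.
  apply: leq_trans le_ext; apply: leq_ltn_trans (leq_imset_card _ _) _.
  rewrite -cardsT; apply: proper_card; apply/properP; split; first exact: subsetT.
  by exists v; rewrite ?inE ?eqxx.
case/subsetPn=> x x_ext x_new; exists (upd phi v x).
  move=> u u' uW u'W; rewrite !ffunE.
  have new w : w \in W -> w != v -> x != phi w.
    move=> wW wv; apply: contraNneq x_new => ->; apply: imset_f.
    by rewrite !inE wv.
  have [->|uv] := eqVneq u v; have [->|u'v] := eqVneq u' v => //.
  - by move/eqP; rewrite (negPf (new _ u'W u'v)).
  - by move/esym/eqP; rewrite (negPf (new _ uW uv)).
  - by apply: phi_inj; rewrite !inE ?uv ?u'v.
move=> e c eH; move: x_ext; rewrite inE => /forallP/(_ e).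
have [ve|ve] := boolP (v \in e); rewrite eH /=.
  by move=> /forallP/(_ c); rewrite setD1K.
move=> _; have := phiW e c eH; congr (_ \in G); apply: eq_in_imset => u ue.
have uv : u != v by apply: contraNneq ve => <-.
by rewrite /fill !inE uv ffunE (negPf uv).
Qed.

(** Resampling the tuple of the part of [v] does not change [L]; if [#|L| < #|V|], at most
    [#|V| ^ s.+1] tuples have all entries in [L]. *)
Lemma card_bad v W phi : v \notin W ->
  #|[set T | bad T v W phi]| * #|X| ^ s.+1 <= #|{: tuples}| * #|V| ^ s.+1.
Proof.
move=> vW; rewrite mulnC.
have -> : #|X| ^ s.+1 = #|{: {ffun 'I_s.+1 -> X}}| by rewrite card_ffun card_ord.
rewrite -sum1_card big_mkcond -(sum_resample (part v)) -sum_nat_const.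
apply: leq_sum => T _.
pose L := extensions T v W phi.
have Lupd y : extensions (upd T (part v) y) v W phi = L.
  by apply: eq_extensions => // i /negPf E; rewrite ffunE E.
have badE y : (upd T (part v) y \in [set T | bad T v W phi]) =
  (y \in ffun_on (mem L)) && (#|L| < #|V|).
  by rewrite inE /bad Lupd upd_same.
under eq_bigr do rewrite badE.
have [ltL|leL] := ltnP #|L| #|V|; last first.
  by rewrite big1 // => y _; rewrite andbF.
under eq_bigr do rewrite andbT.
rewrite -big_mkcond sum1_card card_ffun_on card_ord.
by rewrite leq_exp2r // ltnW.
Qed.

(** Union bound. Only the values of [phi] on at most [d] neighbours matter, so [phi] is set to [x0]
    elsewhere, which leaves [#|X| ^ d] choices. *)
Lemma card_all_bad : 0 < #|X| ->
  #|[set T | [exists v, exists W : {set V}, exists phi : {ffun V -> X},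
      [&& v \notin W, #|nbrs H v W| <= d & bad T v W phi]]]| * #|X| ^ s.+1 <=
  #|V| * 2 ^ #|V| * #|X| ^ d * #|V| ^ s.+1 * #|{: tuples}|.
Proof.
move=> X0; have /card_gt0P[x0 _] := X0.
pose P (p : V * {set V} * {ffun V -> X}) :=
  [&& p.1.1 \notin p.1.2, #|nbrs H p.1.1 p.1.2| <= d &
   p.2 \in pffun_on x0 (nbrs H p.1.1 p.1.2) (mem [set: X])].
pose B (p : V * {set V} * {ffun V -> X}) := [set T | bad T p.1.1 p.1.2 p.2].
set A := [set T | _].
have leA : #|A| <= \sum_(p | P p) #|B p|.
  apply: card_union_bound => T; rewrite inE.
  case/existsP=> v /existsP[W /existsP[phi /and3P[vW dW badT]]].
  pose phi' := [ffun u => if u \in nbrs H v W then phi u else x0] : {ffun V -> X}.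
  exists (v, W, phi').
    rewrite /P /= vW dW /=; apply/pffun_onP; split=> [|u]; last by rewrite inE.
    apply/subsetP=> u; apply: contraLR => /negPf uN.
    by rewrite unfold_in /= ffunE uN eqxx.
  rewrite inE /= /bad (@eq_extensions T T v W phi' phi) // => u uN.
  by rewrite ffunE uN.
apply: leq_trans (leq_mul leA (leqnn _)) _; rewrite big_distrl /=.
apply: (@leq_trans (\sum_(p | P p) #|{: tuples}| * #|V| ^ s.+1)).
  by apply: leq_sum => p /and3P[vW _ _]; apply: card_bad.
rewrite sum_nat_cond_const -mulnA [#|V| ^ _ * _]mulnC leq_mul2r.
apply/orP; right.
rewrite -sum1_card (eq_bigl (fun p => true && P (p.1, p.2))); last first.
  by case=> p q; rewrite inE.
rewrite -(pair_big_dep predT (fun p q => P (p, q)) (fun _ _ => 1)) /=.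
have -> : #|V| * 2 ^ #|V| = #|{: V * {set V}}|.
  by rewrite card_prod -[#|{: {set V}}|]cardsT -powersetT card_powerset cardsT.
rewrite -sum_nat_const; apply: leq_sum => p _; rewrite sum1_card.
have [le_d|gt_d] := leqP #|nbrs H p.1 p.2| d; last first.
  by rewrite eq_card0 // => q; apply/negbTE/negP=> /and3P[].
apply: (@leq_trans #|pffun_on x0 (mem (nbrs H p.1 p.2)) (mem [set: X])|).
  by apply: subset_leq_card; apply/subsetP=> q /and3P[].
by rewrite card_pffun_on cardsT leq_pexp2l.
Qed.

Hypothesis G_unif : uniform k G.
Hypothesis G_free : ~~ contains_copy H G.

Lemma blowup_bad T :
  T \in blowup s (fun g => [set g i | i : 'I_k] \in G) k -> H != set0 ->
  [exists v, exists W : {set V}, exists phi : {ffun V -> X},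
      [&& v \notin W, #|nbrs H v W| <= d & bad T v W phi]].
Proof.
rewrite inE => /forallP Tblow /set0Pn[e0 e0H].
apply: contraNT G_free; rewrite negb_exists => /forallP good.
have good' v W phi : v \notin W -> #|nbrs H v W| <= d -> ~~ bad T v W phi.
  move=> vW dW; have := good v; rewrite negb_exists => /forallP/(_ W).
  by rewrite negb_exists => /forallP/(_ phi); rewrite vW dW.
pose phi0 : {ffun V -> X} := [ffun u => T (part u) ord0].
have T0 : partial_copy T set0 phi0.
  move=> e c eH; have /implyP := Tblow c.
  (* At level [k] every coordinate is blown up, so the side condition on [c] is void. *)
  have -> : [forall i : 'I_k, (k <= i) ==> (c i == ord0)].
    by apply/forallP=> i; rewrite leqNgt ltn_ord.
  move=> /(_ isT); congr (_ \in G); apply/setP=> x.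
  apply/imsetP/imsetP => [[i _ ->]|[u ue ->]].
    have [u ue <-] := part_surj i eH; exists u => //.
    by rewrite /fill inE ffunE.
  by exists (part u) => //; rewrite /fill inE ffunE.
have [phi phi_inj phiT] := greedy_embedding T0 good' [set: V].
apply/existsP; exists phi; apply/andP; split.
  by apply/injectiveP=> u v; apply: phi_inj; rewrite inE.
apply/forallP=> e; apply/implyP=> eH.
have := phiT e [ffun=> ord0] eH; congr (_ \in G); apply: eq_imset => u.
by rewrite /fill inE.
Qed.

Lemma card_le_ordered : #|G| <= #|(fun g : {ffun 'I_k -> X} => [set g i | i : 'I_k] \in G)|.
Proof.
pose P := [set g : {ffun 'I_k -> X} | [set g i | i : 'I_k] \in G].
apply: (@leq_trans #|P|); last by apply/subset_leq_card/subsetP=> g; rewrite inE.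
apply: leq_trans (leq_imset_card (fun g : {ffun 'I_k -> X} => [set g i | i : 'I_k]) _).
apply: subset_leq_card; apply/subsetP=> e eG.
have /eqP ek : #|e| == k by move/forallP: G_unif => /(_ e); rewrite eG.
pose g := [ffun i : 'I_k => enum_val (cast_ord (esym ek) i)] : {ffun 'I_k -> X}.
have eE : e = [set g i | i : 'I_k].
  apply/setP=> x; apply/idP/imsetP => [xe|[i _ ->]].
    exists (cast_ord ek (enum_rank_in xe x)) => //.
    by rewrite ffunE cast_ordK enum_rankK_in.
  by rewrite ffunE enum_valP.
by apply/imsetP; exists g; rewrite // inE -eE.
Qed.

(** As [G] has no copy of [H], every full blow-up is bad: the lower bound from convexity meets the
    upper bound from the union bound. *)
Lemma free_card_bound : 0 < #|X| -> H != set0 -> d < s ->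
  #|G| ^ (s.+1 ^ k) * #|X| ^ (s.+1 - d) <=
  #|V| * 2 ^ #|V| * #|V| ^ s.+1 * #|X| ^ (k * s.+1 ^ k).
Proof.
move=> X0 H0 lt_ds.
pose P := (fun g : {ffun 'I_k -> X} => [set g i | i : 'I_k] \in G).
set M := #|V| * 2 ^ #|V| * #|V| ^ s.+1; set q := s.+1 ^ k.
set N := #|{: tuples}|.
have NE : N = #|X| ^ (s.+1 * k) by rewrite /N !card_ffun !card_ord expnM.
have q0 : 0 < q by rewrite expn_gt0.
have bad_bound : #|blowup s P k| * #|X| ^ s.+1 <= M * #|X| ^ d * N.
  apply: leq_trans (leq_trans (card_all_bad X0) _); last first.
    by rewrite /M -!mulnA leq_mul2l [#|X| ^ d * _]mulnCA leqnn !orbT.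
  rewrite leq_mul2r; apply/orP; right; apply: subset_leq_card.
  by apply/subsetP=> T TP; rewrite inE; apply: blowup_bad.
clearbody M.
have := blowup_iter s P X0 (leqnn k); rewrite card_blowup0 // -/q -/N => main.
have GP : (#|G| * #|X| ^ (k * s)) ^ q <= #|blowup s P k| * N ^ q.-1.
  apply: leq_trans main; rewrite leq_exp2r // leq_mul2r.
  by rewrite card_le_ordered orbT.
rewrite -(@leq_pmul2r (#|X| ^ d * #|X| ^ (k * s * q))); last first.
  by rewrite muln_gt0 !expn_gt0 X0.
have -> : #|G| ^ q * #|X| ^ (s.+1 - d) * (#|X| ^ d * #|X| ^ (k * s * q)) =
   (#|G| * #|X| ^ (k * s)) ^ q * #|X| ^ s.+1.
  rewrite expnMn -expnM -!mulnA; congr (_ * _).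
  rewrite mulnA -expnD subnK 1?mulnC //; lia.
apply: leq_trans (leq_mul GP (leqnn _)) _.
rewrite mulnAC; apply: leq_trans (leq_mul bad_bound (leqnn _)) _.
rewrite -mulnA -expnS prednK // NE -expnM -!mulnA leq_mul2l; apply/orP; right.
by rewrite -!expnD (_ : d + _ = k * q + (d + k * (s * q))) //; lia.
Qed.

End Embedding.

(** * Cliques of a random graph *)

Lemma sum_degree (V : finType) (W : {set V}) (F : {set {set V}}) r :
  (forall e, e \in F -> e \subset W) -> (forall e, e \in F -> #|e| = r) ->
  \sum_(v in W) degree F v = r * #|F|.
Proof.
move=> FW Fr; rewrite mulnC -sum_nat_const.
have degE v : degree F v = \sum_(e in F) (v \in e).
  rewrite /degree -sum1_card big_mkcond [RHS]big_mkcond /=.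
  by apply: eq_bigr => e _; rewrite inE; case: (e \in F) => //=; case: (v \in e).
under eq_bigr do rewrite degE.
rewrite exchange_big /=; apply: eq_bigr => e eF.
rewrite -(Fr e eF) -sum1_card big_mkcond [RHS]big_mkcond /=.
apply: eq_bigr => v _; have [ve|] := boolP (v \in e); last by case: ifP.
by rewrite (subsetP (FW e eF)).
Qed.

Lemma min_degree_leq (V : finType) (W : {set V}) (F : {set {set V}}) v :
  v \in W -> min_degree W F <= degree F v.
Proof.
move=> vW; rewrite /min_degree; have := mem_index_enum v.
elim: (index_enum V) => // u r IH; rewrite inE big_cons => /predU1P[<-|/IH le_v].
  by rewrite vW geq_minl.
by case: ifP => // _; apply: leq_trans (geq_minr _ _) le_v.
Qed.

(** A single pair inside an edge is a subgraph of minimum degree one. *)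
Lemma skeletal_degeneracy_gt0 (V : finType) (H : {set {set V}}) e :
  e \in H -> 2 <= #|e| -> 0 < skeletal_degeneracy 1 H.
Proof.
move=> eH /card_gt1P[u [v [ue ve uv]]].
rewrite /skeletal_degeneracy /degeneracy lt0n; case: ex_minnP => d.
move=> /forallP/(_ [set u; v])/forallP/(_ [set [set u; v]])/implyP degH _.
apply: contraTneq (degH _) => [d0|].
  rewrite d0 -ltnNge; apply: leq_min_degree => [|w wW].
    by apply/set0Pn; exists u; rewrite set21.
  by apply/card_gt0P; exists [set u; v]; rewrite inE set11.
apply/and3P; split; first by apply/set0Pn; exists u; rewrite set21.
  rewrite sub1set inE cards2 uv /=; apply/existsP; exists e.
  by rewrite eH subUset !sub1set ue ve.
by apply/forallP=> s; apply/implyP=> /set1P->.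
Qed.

(** By minimality of the degeneracy [d], some subgraph has minimum degree at least [d]; then degrees
    are summed. *)
Lemma dense_subskeleton (V : finType) (H : {set {set V}}) :
  0 < skeletal_degeneracy 1 H ->
  exists W : {set V}, exists F : {set {set V}},
    [/\ 0 < #|W|, F \subset skeleton 1 H, forall e, e \in F -> e \subset W &
        skeletal_degeneracy 1 H * #|W| <= 2 * #|F|].
Proof.
rewrite /skeletal_degeneracy /degeneracy; case: ex_minnP => d _ d_min d0.
have : ~~ degenerate d.-1 (skeleton 1 H).
  by apply/negP=> /d_min; rewrite leqNgt prednK ?leqnn.
case/forallPn=> W /forallPn[F]; rewrite negb_imply -ltnNge prednK //.
case/andP=> /and3P[W0 FH /forallP FW] le_d; exists W, F.
have FW' e : e \in F -> e \subset W by move=> eF; have := FW e; rewrite eF.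
split=> //; first by rewrite card_gt0.
rewrite -(@sum_degree V W F 2) // => [|e /(subsetP FH)]; last first.
  by rewrite inE => /andP[/eqP].
rewrite mulnC -sum_nat_const; apply: leq_sum => v vW.
by apply: leq_trans le_d _; exact: min_degree_leq.
Qed.

Section RandomColouring.
Variables (X : finType) (k q : nat).
Local Notation colouring := {ffun {set X} -> 'I_q.+1}.
Implicit Type f : colouring.

(* The random graph consists of the pairs of colour [0]; the colours of the
   other subsets of [X] are irrelevant. *)
Definition vanish_on (S : {set {set X}}) : {set colouring} :=
  [set f : colouring | [forall s in S, f s == ord0]].

(** Colours are independent and each set in [S] has colour [0] with probability [1 / q.+1]. *)
Lemma card_vanish_on S : #|vanish_on S| * q.+1 ^ #|S| = #|{: colouring}|.
Proof.
pose fam (s : {set X}) := if s \in S then mem [set ord0] else mem [set: 'I_q.+1].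
have -> : #|vanish_on S| = #|family fam|.
  apply: eq_card => f; rewrite inE; apply/forallP/familyP => fS s.
    by have := fS s; rewrite /fam; case: ifP => _; rewrite !inE.
  by have := fS s; rewrite /fam; case: ifP => _; rewrite !inE.
rewrite card_family foldrE big_map big_enum /= card_ffun card_ord.
rewrite -(cardC (mem S)) addnC expnD; congr (_ * _).
rewrite (bigID (mem S)) /= big1 ?mul1n => [|s sS]; last first.
  by rewrite /fam sS cards1.
rewrite -prod_nat_const; apply: eq_big => [s|s /negPf sS]; first by rewrite inE.
by rewrite /fam sS cardsT card_ord.
Qed.

Definition pairs (e : {set X}) : {set {set X}} :=
  [set s : {set X} | s \subset e & #|s| == 2].

Definition clique_hypergraph f : {set {set X}} :=
  [set e : {set X} | (#|e| == k) && (f \in vanish_on (pairs e))].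

Lemma clique_hypergraph_uniform f : uniform k (clique_hypergraph f).
Proof. by apply/forallP=> e; apply/implyP; rewrite inE => /andP[]. Qed.

Lemma card_clique_hypergraph f : #|clique_hypergraph f| <= 'C(#|X|, k).
Proof.
rewrite -cardsT -cards_draws; apply: subset_leq_card; apply/subsetP=> e.
by rewrite !inE subsetT => /andP[].
Qed.

Lemma sum_clique_hypergraph :
  (\sum_f #|clique_hypergraph f|) * q.+1 ^ 'C(k, 2) =
  'C(#|X|, k) * #|{: colouring}|.
Proof.
have -> : \sum_f #|clique_hypergraph f| =
    \sum_(e : {set X} | #|e| == k) #|vanish_on (pairs e)|.
  under eq_bigr do rewrite -sum1_card big_mkcond.
  rewrite exchange_big [RHS]big_mkcond /=; apply: eq_bigr => e _.
  case: ifP => ek; last by rewrite big1 // => f _; rewrite inE ek.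
  by rewrite -sum1_card [RHS]big_mkcond; apply: eq_bigr => f _; rewrite inE ek.
rewrite -cardsT -cards_draws -sum_nat_const big_distrl /=.
apply: eq_big => [e|e /eqP ek]; first by rewrite inE subsetT.
by rewrite -(card_vanish_on (pairs e)) cards_draws ek.
Qed.

Variables (V : finType) (H : {set {set V}}) (W : {set V}) (F : {set {set V}}).
Hypotheses (X_gt0 : 0 < #|X|) (F_skel : F \subset skeleton 1 H).
Hypothesis F_W : forall e, e \in F -> e \subset W.

(** Injectivity is asked on [W] only, so that the union bound costs [#|X| ^ #|W|]. *)
Definition has_copy_of_F f : bool :=
  [exists phi : {ffun V -> X}, dinjectiveb phi (mem W) &&
     [forall s in F, f [set phi x | x in s] == ord0]].

(** A pair in [F] lies in an edge of [H], whose image in a copy would be a clique. *)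
Lemma clique_hypergraph_free f :
  ~~ has_copy_of_F f -> ~~ contains_copy H (clique_hypergraph f).
Proof.
apply: contraNN => /existsP[phi /andP[/injectiveP phi_inj /forallP phiH]].
apply/existsP; exists phi; apply/andP; split.
  by apply/dinjectiveP=> u v _ _; apply: phi_inj.
apply/forallP=> s; apply/implyP=> /(subsetP F_skel).
rewrite inE => /andP[s2 /existsP[e /andP[eH se]]].
have := phiH e; rewrite eH inE /= => /andP[_].
rewrite inE => /forallP/(_ [set phi x | x in s]); rewrite inE.
by rewrite imsetS //= card_imset // s2.
Qed.

Lemma card_has_copy_of_F :
  #|[set f | has_copy_of_F f]| * q.+1 ^ #|F| <= #|X| ^ #|W| * #|{: colouring}|.
Proof.
have /card_gt0P[x0 _] := X_gt0.
pose P (phi : {ffun V -> X}) :=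
  (phi \in pffun_on x0 (mem W) (mem [set: X])) && dinjectiveb phi (mem W).
pose B (phi : {ffun V -> X}) := vanish_on [set [set phi x | x in s] | s : {set V} in F].
have leA : #|[set f | has_copy_of_F f]| <= \sum_(phi | P phi) #|B phi|.
  apply: card_union_bound => f; rewrite inE => /existsP[phi].
  case/andP=> /dinjectiveP phi_inj /forallP phiF.
  pose psi := [ffun u => if u \in W then phi u else x0] : {ffun V -> X}.
  have psiE : {in W, psi =1 phi} by move=> u uW; rewrite ffunE uW.
  exists psi.
    apply/andP; split.
      apply/pffun_onP; split=> [|u]; last by rewrite inE.
      apply/subsetP=> u; apply: contraLR => /negPf uN.
      by rewrite unfold_in /= ffunE uN eqxx.
    by apply/dinjectiveP=> u v uW vW; rewrite !psiE //; apply: phi_inj.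
  rewrite inE; apply/forallP=> s'; apply/implyP=> /imsetP[s sF ->].
  have := phiF s; rewrite sF /= => /eqP <-; apply/eqP; congr (f _).
  by apply: eq_in_imset => u us; apply/psiE/(subsetP (F_W sF)).
apply: leq_trans (leq_mul leA (leqnn _)) _; rewrite big_distrl /=.
apply: (@leq_trans (\sum_(phi | P phi) #|{: colouring}|)).
  apply: leq_sum => phi /andP[_ /dinjectiveP phi_inj].
  rewrite -(card_vanish_on [set [set phi x | x in s] | s : {set V} in F]).
  rewrite card_in_imset // => s s' sF s'F E; apply/setP=> u.
  (* An injection on [W] keeps the pairs of [F] distinct, so exactly [#|F|] colours are forced. *)
  suff mem_im (r : {set V}) : r \in F ->
      (u \in r) = (u \in W) && (phi u \in [set phi x | x in r]).
    by rewrite (mem_im s sF) (mem_im s' s'F) E.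
  move=> rF; apply/idP/andP => [ur|[uW /imsetP[v vr /phi_inj ->]]] //.
    by rewrite (subsetP (F_W rF)) // imset_f.
  exact: (subsetP (F_W rF)).
rewrite sum_nat_cond_const leq_mul2r; apply/orP; right.
apply: (@leq_trans #|pffun_on x0 (mem W) (mem [set: X])|).
  by apply: subset_leq_card; apply/subsetP=> phi; rewrite inE => /andP[].
by rewrite card_pffun_on cardsT.
Qed.

(** Averaging: colourings with a copy of [F] are so rare that, even with all [k]-sets counted for
    each, they carry at most half of the expected number of cliques. *)
Lemma random_cliques_bound t :
  'C(k, 2) <= #|F| -> 2 * #|X| ^ #|W| <= q.+1 ^ (#|F| - 'C(k, 2)) ->
  (forall G : {set {set X}}, uniform k G -> ~~ contains_copy H G -> #|G| <= t) ->
  'C(#|X|, k) <= 2 * q.+1 ^ 'C(k, 2) * t.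
Proof.
set K := 'C(k, 2); set C := 'C(#|X|, k) => leKF ltW le_t.
set N := #|{: colouring}|; set b := #|[set f | has_copy_of_F f]|.
have N0 : 0 < N by rewrite /N card_ffun card_ord expn_gt0.
have few_bad : 2 * q.+1 ^ K * b <= N.
  rewrite -(@leq_pmul2l (#|X| ^ #|W|)) ?expn_gt0 ?X_gt0 //.
  apply: leq_trans card_has_copy_of_F; rewrite -/b -(subnK leKF) expnD -/K.
  move: ltW; set x := _ ^ #|W|; set y := _ ^ (_ - _); set z := q.+1 ^ K.
  by move: x y z b => x y z b le; have := leq_mul le (leqnn (z * b)); nia.
have total : C * N <= q.+1 ^ K * (N * t + b * C).
  rewrite -sum_clique_hypergraph mulnC leq_mul2l; apply/orP; right.
  have -> : b * C = \sum_f has_copy_of_F f * C.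
    rewrite -big_distrl /= /b -sum1_card big_mkcond; congr (_ * _).
    by apply: eq_bigr => f _; rewrite inE; case: (has_copy_of_F f).
  rewrite -sum_nat_const -big_split /=; apply: leq_sum => f _.
  have [_|free] := boolP (has_copy_of_F f).
    by rewrite mul1n (leq_trans (card_clique_hypergraph f)) // leq_addl.
  by rewrite addn0 le_t ?clique_hypergraph_uniform // clique_hypergraph_free.
rewrite -(leq_pmul2r N0); move: few_bad total.
move: (q.+1 ^ K) => Q; move: C N N0 b => C N N0 b le1 le2.
have := leq_mul le1 (leqnn C); nia.
Qed.

End RandomColouring.

(** * The lower bound in natural numbers *)

Lemma turan_ge_clique (V : finType) (H : {set {set V}}) (k n : nat)
    (W : {set V}) (F : {set {set V}}) q :
  0 < n -> F \subset skeleton 1 H -> (forall e, e \in F -> e \subset W) ->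
  'C(k, 2) <= #|F| -> 2 * n ^ #|W| <= q.+1 ^ (#|F| - 'C(k, 2)) ->
  'C(n, k) <= 2 * q.+1 ^ 'C(k, 2) * turan k n H.
Proof.
move=> n0 FH FW KF big; have := @random_cliques_bound 'I_n k q V H W F.
rewrite card_ord; apply => // G Gk Gfree.
by apply: (@leq_bigmax_cond _ _ (fun G : {set {set 'I_n}} => #|G|)); rewrite Gk.
Qed.

(** A single edge contains no copy, since an injection keeps two edges distinct. *)
Lemma turan_gt0 (V : finType) (H : {set {set V}}) (k n : nat) :
  k <= n -> 2 <= #|H| -> 0 < turan k n H.
Proof.
move=> le_kn H2.
have : 0 < #|[set A : {set 'I_n} | A \subset [set: 'I_n] & #|A| == k]|.
  by rewrite cards_draws cardsT card_ord bin_gt0.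
case/card_gt0P=> e; rewrite inE => /andP[_ ek].
have -> : 1 = #|[set e]| by rewrite cards1.
apply: (@leq_bigmax_cond _ _ (fun G : {set {set 'I_n}} => #|G|)).
apply/andP; split; first by apply/forallP=> s; apply/implyP=> /set1P->.
apply/negP=> /existsP[phi /andP[/injectiveP phi_inj /forallP phiH]].
suff : #|H| <= 1 by rewrite leqNgt H2.
rewrite -(card_imset (mem H) (imset_inj phi_inj)) -(cards1 e).
apply: subset_leq_card; apply/subsetP=> _ /imsetP[s sH ->].
by have := phiH s; rewrite sH.
Qed.

(** Each of the [k] factors of the falling factorial is at least [n - k], hence at least [n / 2]. *)
Lemma bin_lower n k : 2 * k <= n -> n ^ k <= 2 ^ k * k`! * 'C(n, k).
Proof.
move=> le_kn; rewrite -mulnA [k`! * _]mulnC bin_ffact.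
apply: (@leq_trans (2 ^ k * (n - k) ^ k)).
  rewrite -expnMn; have [->//|k0] := posnP k.
  by rewrite leq_exp2r //; lia.
rewrite leq_mul2l; apply/orP; right.
suff le_ffact j : j <= k -> (n - k) ^ j <= n ^_ j by exact: le_ffact.
elim: j => [|j IH] ltjk; first by rewrite ffactn0.
rewrite ffactnSr expnSr leq_mul ?IH ?(ltnW ltjk) //; lia.
Qed.

(** Here [q.+1] is [n ^ (8 / d)] rounded up. Since [#|F| - 'C(k, 2)] is at least [d * #|W| / 4], the
    power required of [q.+1] is at least [n ^ (2 * #|W|)], which absorbs the factor [2]. *)
Lemma turan_lower_nat (V : finType) (H : {set {set V}}) (k n : nat) :
  let d := skeletal_degeneracy 1 H in
  2 <= n -> 2 * k <= n -> 0 < d -> 4 * 'C(k, 2) <= d ->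
  exists2 q, q ^ d < n ^ 8 &
    n ^ k <= 2 ^ k * k`! * (2 * q.+1 ^ 'C(k, 2)) * turan k n H.
Proof.
move=> d n2 kn d0 Kd.
have ex_m : exists m, n ^ 8 <= m ^ d.
  by exists (n ^ 8); rewrite -{1}[n ^ 8]expn1 leq_pexp2l // expn_gt0; lia.
have [m le_m m_min] := ex_minnP ex_m.
case: m le_m m_min => [|q] le_q q_min.
  by move: le_q; rewrite exp0n // leqNgt expn_gt0 (ltnW n2).
exists q; first by rewrite ltnNge; apply/negP=> /q_min; rewrite ltnn.
apply: leq_trans (bin_lower kn) _; rewrite -!mulnA !leq_mul2l; apply/orP; right.
apply/orP; right; rewrite mulnA.
have [W [F [W0 FH FW dW]]] := dense_subskeleton d0.
have KF : 'C(k, 2) <= #|F| by move: dW; rewrite -/d; nia.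
apply: (turan_ge_clique _ FH FW KF); first exact: ltnW.
have four : d * #|W| <= 4 * (#|F| - 'C(k, 2)) by move: dW; rewrite -/d; nia.
(* Fourth powers avoid the division by four in the exponent. *)
rewrite -(@leq_exp2r _ _ 4) // -expnM.
apply: (@leq_trans (q.+1 ^ (d * #|W|))); last first.
  by rewrite leq_pexp2l // [leqRHS]mulnC.
apply: (@leq_trans (n ^ (8 * #|W|))); last first.
  by rewrite !expnM leq_exp2r.
rewrite expnMn -expnM (_ : 8 * #|W| = #|W| * 4 + #|W| * 4); last by lia.
rewrite expnD leq_mul2r; apply/orP; right.
by apply: leq_trans (leq_pexp2l (ltnW n2) (_ : 4 <= _)); [rewrite leq_exp2r | lia].
Qed.

(** * Real exponents *)

Lemma turan0 (V : finType) (H : {set {set V}}) k : 0 < k -> turan k 0 H = 0.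
Proof.
move=> k0; apply/eqP; rewrite -leqn0; apply/bigmax_leqP=> G /andP[/forallP Gk _].
rewrite leqn0 cards_eq0; apply/set0Pn=> -[e eG].
have := Gk e; rewrite eG /= => /eqP ek.
by have := max_card (mem e); rewrite ek card_ord leqNgt k0.
Qed.

(** For [s = 2 * d] the gain [n ^ (s.+1 - d)] is [n ^ d.+1]. *)
Lemma turan_upper_nat (V : finType) (H : {set {set V}}) (k n : nat) :
  let d := skeletal_degeneracy 1 H in
  let s := (2 * d)%N in
  partite k H -> H != set0 -> 0 < d -> 0 < n ->
  turan k n H ^ (s.+1 ^ k) * n ^ d.+1 <=
  #|V| * 2 ^ #|V| * #|V| ^ s.+1 * n ^ (k * s.+1 ^ k).
Proof.
move=> d s [part H_part] H0 d0 n0.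
suff bound (G : {set {set 'I_n}}) : uniform k G -> ~~ contains_copy H G ->
    #|G| ^ (s.+1 ^ k) * n ^ d.+1 <=
    #|V| * 2 ^ #|V| * #|V| ^ s.+1 * n ^ (k * s.+1 ^ k).
  rewrite /turan; apply: (big_ind (fun t => t ^ (s.+1 ^ k) * n ^ d.+1 <= _)).
  - by rewrite exp0n ?expn_gt0 // mul0n.
  - by move=> x y le_x le_y; rewrite /maxn; case: ifP.
  - by move=> G /andP[]; apply: bound.
move=> Gk Gfree.
have := free_card_bound (s := s) (d := d) H_part (@low_degree_vertex V H) Gk Gfree.
rewrite card_ord (_ : s.+1 - d = d.+1); last by rewrite /s; lia.
by apply=> //; rewrite /s; lia.
Qed.

Import Order.TTheory GRing.Theory Num.Theory.
Local Open Scope ring_scope.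

Lemma turan_upper (R : realType) (k : nat) (V : finType) (H : {set {set V}}) :
  let d := skeletal_degeneracy 1 H in
  (2 <= k)%N -> partite k H -> H != set0 -> (0 < d)%N ->
  exists B : R, 0 < B /\ forall n : nat,
    (turan k n H)%:R <= B * n%:R `^ (k%:R - (3 ^- k) / d%:R ^+ (k - 1)).
Proof.
move=> d k2 Hpart H0 d0; pose s := (2 * d)%N; pose Q := (s.+1 ^ k)%N.
pose M := (#|V| * 2 ^ #|V| * #|V| ^ s.+1)%N.
have Q0 : (0 < Q)%N by rewrite expn_gt0.
(* The successor makes the constant positive and at most its own [Q]-th power. *)
exists M.+1%:R; split=> [|n]; first by rewrite ltr0n.
have [->|n0] := posnP n.
  by rewrite turan0 ?(ltnW k2) // mulr_ge0 ?powR_ge0.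
set eps := _ / _; set t := turan k n H.
have n1 : 1 <= n%:R :> R by rewrite ler1n.
have nz : n%:R != 0 :> R by rewrite pnatr_eq0 -lt0n.
(* After taking [Q]-th powers, this is what is required of [eps]. *)
have epsQ : eps * Q%:R <= d.+1%:R.
  have d0' : 0 < d%:R :> R by rewrite ltr0n.
  apply: (@le_trans _ _ d%:R); last by rewrite ler_nat.
  (* [2 d + 1 <= 3 d] *)
  have QE : Q%:R <= (3 * d%:R) ^+ k :> R.
    by rewrite /Q natrX -natrM lerXn2r ?nnegrE ?ler0n // ler_nat /s; lia.
  apply: (@le_trans _ _ (eps * (3 * d%:R) ^+ k)).
    by rewrite ler_wpM2l // /eps divr_ge0 // ?invr_ge0 exprn_ge0.
  have dk : d%:R ^+ k = d%:R ^+ (k - 1) * d%:R :> R.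
    by rewrite -exprSr subn1 prednK // ltnW.
  rewrite /eps exprMn dk.
  set x := d%:R ^+ _; have x0 : x != 0 by rewrite expf_neq0 // gt_eqF.
  have y0 : 3 ^+ k != 0 :> R by rewrite expf_neq0 // pnatr_eq0.
  rewrite le_eqVlt; apply/orP; left; apply/eqP.
  by field; rewrite x0 y0.
have := turan_upper_nat Hpart H0 d0 n0; rewrite -/t -/d -/s -/Q -/M => main.
rewrite -(@ler_pXn2r _ Q) ?nnegrE ?ler0n ?mulr_ge0 ?powR_ge0 //.
rewrite exprMn -[(n%:R `^ _) ^+ Q]powR_mulrn ?powR_ge0 // -powRrM mulrBl.
rewrite powRB; last by rewrite nz implybT.
rewrite -natrM powR_mulrn ?ler0n // mulrA ler_pdivlMr; last first.
  by rewrite powR_gt0 // ltr0n.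
apply: (@le_trans _ _ (t%:R ^+ Q * n%:R ^+ d.+1)).
  rewrite ler_wpM2l ?exprn_ge0 // -powR_mulrn ?ler0n //.
  exact: ler_powR.
rewrite -!natrX -!natrM ler_nat; apply: leq_trans main _.
rewrite leq_mul2r; apply/orP; right.
apply: leq_trans (leqnSn M) _; rewrite -{1}[M.+1]expn1.
by rewrite leq_pexp2l.
Qed.

(** In the exponent, [4 * K * k] serves the case [d < 4 * K] and [8 * K] the other. The constant
    collects [2 ^ k * k!] from the binomial, [2] from averaging and [2 ^ K] from rounding. *)
Lemma turan_lower (R : realType) (k n : nat) (V : finType) (H : {set {set V}}) :
  let d := skeletal_degeneracy 1 H in
  let K := 'C(k, 2) in
  (2 <= k)%N -> (2 * k <= n)%N -> (0 < d)%N -> (2 <= #|H|)%N ->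
  (2 ^ (k + K + 1) * k`!)%N%:R^-1 *
    n%:R `^ (k%:R - (4 * K * k + 8 * K)%N%:R / d%:R) <= (turan k n H)%:R :> R.
Proof.
move=> d K k2 kn d0 H2; set c := (_ * k`!)%N.
have n2 : (2 <= n)%N by lia.
have d0' : 0 < d%:R :> R by rewrite ltr0n.
have n1 : 1 <= n%:R :> R by rewrite ler1n; lia.
have nz : n%:R != 0 :> R by rewrite pnatr_eq0; lia.
have c0 : (0 < c)%N by rewrite muln_gt0 expn_gt0 fact_gt0.
(* If [d < 4 * K], the exponent of [n] is not positive and one edge is enough. *)
have [Kd|dK] := leqP (4 * K) d; last first.
  apply: (@le_trans _ _ 1); last by rewrite ler1n turan_gt0 //; lia.
  rewrite mulrC ler_pdivrMr ?ltr0n // mul1r.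
  apply: (@le_trans _ _ 1); last by rewrite ler1n.
  rewrite -[leRHS](@powRr0 _ n%:R); apply: ler_powR => //.
  rewrite subr_le0 ler_pdivlMr // -natrM ler_nat; nia.
have [q q_lt main] := turan_lower_nat n2 kn d0 Kd.
rewrite -/K -/d in q_lt main; set t := turan k n H in main *.
pose y : R := n%:R `^ (8 / d%:R).
have y1 : 1 <= y.
  by rewrite -[leLHS](@powRr0 _ n%:R) ler_powR // divr_ge0 // ltW.
have y0 : 0 <= y by apply: le_trans y1.
have q_le : q%:R <= y.
  rewrite -(@ler_pXn2r _ d) ?nnegrE //.
  rewrite -[y ^+ d]powR_mulrn // -powRrM divfK ?gt_eqF //.
  by rewrite -[8]/(8%:R) powR_mulrn // -!natrX ler_nat ltnW.
(* As [y >= 1], rounding up at most doubles it. *)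
have q1_le : q.+1%:R ^+ K <= 2 ^+ K * y ^+ K.
  rewrite -exprMn lerXn2r ?nnegrE ?mulr_ge0 //.
  rewrite -natr1; lra.
have yK : y ^+ K = n%:R `^ ((8 * K)%N%:R / d%:R).
  by rewrite -powR_mulrn // -powRrM; congr (_ `^ _); rewrite natrM mulrAC.
apply: (@le_trans _ _ (c%:R^-1 * n%:R `^ (k%:R - (8 * K)%N%:R / d%:R))).
  rewrite ler_wpM2l ?invr_ge0 // ler_powR // lerD2l lerN2.
  by rewrite ler_wpM2r ?invr_ge0 ?ler0n // ler_nat leq_addl.
rewrite powRB; last by rewrite nz implybT.
rewrite -yK powR_mulrn // mulrC ler_pdivrMr ?ltr0n // ler_pdivrMr; last first.
  by rewrite exprn_gt0 // (lt_le_trans ltr01).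
apply: (@le_trans _ _ (2 ^ k * k`! * (2 * q.+1 ^ K) * t)%N%:R).
  by rewrite -natrX ler_nat.
rewrite /c !natrM !natrX !exprD expr1.
set u := 2 ^+ k; set v := 2 ^+ K in q1_le *.
have w0 : 0 <= u * k`!%:R * 2 * t%:R by rewrite !mulr_ge0 ?exprn_ge0.
have := ler_wpM2l w0 q1_le.
rewrite [leLHS](_ : _ = u * k`!%:R * (2 * q.+1%:R ^+ K) * t%:R); last by ring.
by move/le_trans; apply; rewrite le_eqVlt; apply/orP; left; apply/eqP; ring.
Qed.

Theorem theorem1p4 (R : realType) (k : nat) (hk : (2 <= k)%N) :
  exists Ck ck : R, 0 < Ck /\ 0 < ck /\
  exists (a : R) (n0 : nat), 0 < a /\
  forall (V : finType) (H : {set {set V}}),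
    uniform k H -> partite k H -> (2 <= #|H|)%N ->
    (forall n : nat, (n0 <= n)%N ->
       a * n%:R `^ (k%:R - Ck / (skeletal_degeneracy 1 H)%:R)
         <= (turan k n H)%:R) /\
    (exists B : R, 0 < B /\
       forall n : nat,
         (turan k n H)%:R
           <= B * n%:R `^ (k%:R - ck / (skeletal_degeneracy 1 H)%:R ^+ (k - 1))).
Proof.
set K := 'C(k, 2).
have K0 : (0 < K)%N by rewrite bin_gt0.
exists (4 * K * k + 8 * K)%N%:R, (3 ^- k); split; first by rewrite ltr0n; lia.
split; first by rewrite invr_gt0 exprn_gt0.
exists (2 ^ (k + K + 1) * k`!)%N%:R^-1, (2 * k)%N; split.
  by rewrite invr_gt0 ltr0n muln_gt0 expn_gt0 fact_gt0.
move=> V H Hk Hpart H2.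
have [e eH] : exists e, e \in H by apply/card_gt0P; apply: ltnW.
have ek : #|e| = k by move/forallP: Hk => /(_ e); rewrite eH => /eqP.
have d0 : (0 < skeletal_degeneracy 1 H)%N.
  by apply: (skeletal_degeneracy_gt0 eH); rewrite ek.
have H0 : H != set0 by apply/set0Pn; exists e.
by split=> [n kn|]; [apply: turan_lower | apply: turan_upper].
Qed.
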